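(* Let $(X,\mathcal{K})$ be a pair that satisfies $(A0')$ and $(A1)$. (a) For a function $f:X\rightarrow\overline{\mathcal{K}}$ the following statements are equivalent: 1°. $f$ is topical. 2°. $f(\inf X)=\varepsilon$ and $f(y)\otimes(x/y)\leq f(x)$ for all $x,y\in X$. 3°. $f(\inf X)=\varepsilon$ and $f(y)\otimes s_{y,d}(x)\leq f(x)$ for all $x,y\in X$ and all $d\in\overline{\mathcal{K}}$. (b) For a function $f:X\rightarrow\overline{\mathcal{K}}$ the following statements are equivalent: 1°. $f$ is anti-topical. 2°. $f(\inf X)=\top$ and $f(y)\dot{\otimes}(x/y)^{-1}\geq f(x)$ for all $x,y\in X$. 3°. $f(\inf X)=\top$ and $f(y)\dot{\otimes}\overline{s}_{y,d}(x)\geq f(x)$ for all $x,y\in X$ and all $d\in\overline{\mathcal{K}}$.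
   Context: $(A0')$: $\mathcal{K}=(\mathcal{K},\oplus,\otimes)$ is a $b$-complete idempotent semifield, i.e. a semiring with idempotent addition, with zero $\varepsilon$ (neutral for $\oplus$, absorbing for $\otimes$) and unit $e$, in which every $\mu\neq\varepsilon$ is invertible for $\otimes$, ordered by $\lambda\leq\mu\Leftrightarrow\lambda\oplus\mu=\mu$, such that every subset bounded from above has a supremum (its sum) in $\mathcal{K}$ and $\otimes$ distributes over such suprema (such a $\mathcal{K}$ is commutative); and $X$ is a $b$-complete idempotent semimodule over $\mathcal{K}$: a semimodule with idempotent addition, ordered by $x\leq y\Leftrightarrow x\oplus y=y$, in which every subset bounded from above has a supremum (its sum), and the action $(\lambda,x)\mapsto\lambda x$ distributes over suprema of bounded-above sets of scalars and of vectors. Its zero is $\inf X$; thus $\varepsilon x=\inf X$ for $x\in X$ and $\lambda\inf X=\inf X$ for $\lambda\in\mathcal{K}$. $(A1)$: for all $x\in X$, $y\in X\setminus\{\inf X\}$ the set $\{\lambda\in\mathcal{K}:\lambda y\leq x\}$ is bounded from above in $\mathcal{K}$. It is assumed throughout that $\mathcal{K}$ has no greatest element. Minimal enlargement: $\overline{\mathcal{K}}=\mathcal{K}\cup\{\top\}$, with $\top\notin\mathcal{K}$, $\alpha\leq\top$ and $\alpha\oplus\top=\top$ for all $\alpha\in\overline{\mathcal{K}}$. The product $\otimes$ (also written by concatenation) is extended by $\alpha\otimes\top=\top\otimes\alpha=\top$ for $\alpha\in\overline{\mathcal{K}}\setminus\{\varepsilon\}$ and $\alpha\otimes\varepsilon=\varepsilon\otimes\alpha=\varepsilon$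 for $\alpha\in\overline{\mathcal{K}}$. A second product $\dot{\otimes}$ is defined by $\alpha\dot{\otimes}\beta=\alpha\otimes\beta$ for $\alpha,\beta\in\mathcal{K}$, and $\alpha\dot{\otimes}\top=\top\dot{\otimes}\alpha=\top$ for $\alpha\in\overline{\mathcal{K}}$. Conventions: $\varepsilon^{-1}=\top$, $\top^{-1}=\varepsilon$. Suprema and infima of values are taken in $\overline{\mathcal{K}}$. Extended residuation: $x/y:=\sup\{\lambda\in\mathcal{K}:\lambda y\leq x\}\in\overline{\mathcal{K}}$ for all $x,y\in X$ (so $x/\inf X=\top$). A function $f:X\to\overline{\mathcal{K}}$ is topical if it is increasing ($x'\leq x''\Rightarrow f(x')\leq f(x'')$) and homogeneous ($f(\lambda x)=\lambda\otimes f(x)$ for all $x\in X,\lambda\in\mathcal{K}$); it is anti-topical if it is decreasing ($x'\leq x''\Rightarrow f(x')\geq f(x'')$) and anti-homogeneous ($f(\lambda x)=\lambda^{-1}\dot{\otimes}f(x)$ for all $x\in X,\lambda\in\mathcal{K}$). For $x,y\in X$, $d\in\overline{\mathcal{K}}$: $s_{y,d}(x):=\inf\{x/y,d\}$ and $\overline{s}_{y,d}(x):=\sup\{(x/y)^{-1},d\}$. *)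

(* Defs.v *)
From HB Require Import structures.
From mathcomp Require Import all_boot all_order all_algebra.
From mathcomp Require Import boolp classical_sets.

Set Implicit Arguments.
Unset Strict Implicit.
Unset Printing Implicit Defensive.

Import Order.TTheory GRing.Theory.

Local Open Scope classical_set_scope.
Local Open Scope ring_scope.

HB.mixin Record isIdempotentNmodule V of GRing.Nmodule V := {
  addxx : idempotent_op (+%R : V -> V -> V)
}.

#[short(type="idemNmodType")]
HB.structure Definition IdemNmodule :=
  {V of isIdempotentNmodule V & GRing.Nmodule V}.

(* The library's ordered abelian groups prevent a structure joining an order
   and a mere additive monoid, so the natural order x <= y <-> x + y = y is put
   on the alias natural V, and reached from V through the notations below. *)
Definition natural (V : Type) : Type := V.

HB.instance Definition _ (V : choiceType) := Choice.copy (natural V) V.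

Section NaturalOrder.
Variable V : idemNmodType.

Definition le_add (x y : V) : bool := x + y == y.

Lemma le_add_refl : reflexive le_add.
Proof. by move=> x; rewrite /le_add addxx. Qed.
Lemma le_add_anti : antisymmetric le_add.
Proof. by move=> x y /andP[/eqP xy /eqP yx]; rewrite -xy addrC yx. Qed.
Lemma le_add_trans : transitive le_add.
Proof.
by move=> y x z /eqP xy /eqP yz; rewrite /le_add -{1}yz addrA xy yz.
Qed.

HB.instance Definition _ := Order.Le_isPOrder.Build ring_display (natural V)
  le_add_refl le_add_anti le_add_trans.

End NaturalOrder.

Notation "x <=+ y" := (@Order.le _ (natural _) x y)
  (at level 70, no associativity) : ring_scope.
Notation bounded_above A := (@has_ubound _ (natural _) A).
Notation is_sup A s := (@isLub _ (natural _) A s).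

HB.mixin Record isBComplete V of IdemNmodule V := {
  bcomplete : forall A : set V, bounded_above A -> exists s : V, is_sup A s
}.

(* 0 is the sum of the empty set and the least element (lemma infimums_setT0),
   so it is the zero of a semifield as well as inf X for a semimodule X. *)
#[short(type="bcNmodType")]
HB.structure Definition BCompleteNmodule := {V of isBComplete V & IdemNmodule V}.

(* sinv is unconstrained at 0.  Taking A empty and s = 0 is allowed in mul_sup,
   scale_supl and scale_supr, and agrees with l * 0 = 0, 0 *: x = 0, l *: 0 = 0.
   Commutativity follows from the other axioms by Iwasawa's theorem; it comes
   here with ComPzSemiRing, so that one-sided laws suffice. *)
HB.mixin Record isBCompleteSemifield K
    of BCompleteNmodule K & GRing.ComPzSemiRing K := {
  sinv : K -> K;
  mulsV : forall x : K, x != 0 -> x * sinv x = 1;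
  mul_sup : forall (l : K) (A : set K) (s : K),
    is_sup A s -> is_sup [set l * a | a in A] (l * s)
}.

#[short(type="bcSemifieldType")]
HB.structure Definition BCompleteSemifield :=
  {K of isBCompleteSemifield K & BCompleteNmodule K & GRing.ComPzSemiRing K}.

HB.mixin Record isBCompleteSemimodule (K : bcSemifieldType) X
    of BCompleteNmodule X & GRing.LSemiModule K X := {
  scale_supl : forall (A : set K) (s : K) (x : X),
    is_sup A s -> is_sup [set a *: x | a in A] (s *: x);
  scale_supr : forall (l : K) (A : set X) (s : X),
    is_sup A s -> is_sup [set l *: a | a in A] (l *: s)
}.

#[short(type="bcSemimodType")]
HB.structure Definition BCompleteSemimodule (K : bcSemifieldType) :=
  {X of isBCompleteSemimodule K X & BCompleteNmodule X & GRing.LSemiModule K X}.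

Lemma infimums_setT0 (V : bcNmodType) : @infimums _ (natural V) setT 0.
Proof.
split=> [x _|z lbz]; last exact: (lbz 0).
by apply/eqP; rewrite add0r.
Qed.

Definition no_greatest (K : bcSemifieldType) : Prop :=
  ~ exists m : K, forall l : K, l <=+ m.

Definition condA1 (K : bcSemifieldType) (X : bcSemimodType K) : Prop :=
  forall x y : X, y != 0 -> bounded_above [set l : K | l *: y <=+ x].

Inductive with_top (K : Type) : Type := Fin of K | Top.
Arguments Top {K}.

Definition option_of_top K (a : with_top K) : option K :=
  if a is Fin x then Some x else None.
Definition top_of_option K (a : option K) : with_top K :=
  if a is Some x then Fin x else Top.
Lemma option_of_topK K : cancel (@option_of_top K) (@top_of_option K).
Proof. by case. Qed.

HB.instance Definition _ (K : choiceType) :=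
  Choice.copy (with_top K) (can_type (@option_of_topK K)).

Section TopOrder.
Variable K : bcSemifieldType.

Definition le_top (a b : with_top K) : bool :=
  match a, b with
  | _, Top => true
  | Fin x, Fin y => x <=+ y
  | Top, Fin _ => false
  end.

Lemma le_top_refl : reflexive le_top.
Proof. by case=> /=. Qed.
Lemma le_top_anti : antisymmetric le_top.
Proof. by case=> [x|] [y|] //= /(@le_anti _ (natural K)) ->. Qed.
Lemma le_top_trans : transitive le_top.
Proof. by case=> [x|] [y|] [z|] //=; exact: (@le_trans _ (natural K)). Qed.

HB.instance Definition _ := Order.Le_isPOrder.Build ring_display (with_top K)
  le_top_refl le_top_anti le_top_trans.

(* Every subset of with_top K has a least upper and a greatest lower bound, so
   the default value Top of the total functions supremum and infimum is never
   returned for lack of a bound in the nonempty cases used below. *)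
Lemma with_top_lub (A : set (with_top K)) : exists s, isLub A s.
Proof.
have [ub|nub] := pselect (exists x, ubound A (Fin x)); last first.
  exists Top; split=> [[]//|[y|]// uby].
  by case: nub; exists y.
case: ub => x ubx; pose B := [set l | A (Fin l)].
have /bcomplete[s [ubs lubs]] : bounded_above B by exists x => l /ubx.
exists (Fin s); split=> [[l /ubs//|/ubx//]|[y|]// uby].
by apply: lubs => l /uby.
Qed.

Lemma with_top_glb (A : set (with_top K)) : infimums A !=set0.
Proof.
have [s [ubs lubs]] := with_top_lub (lbound A).
by exists s; split=> [a Aa|b /ubs//]; apply: lubs => b; exact.
Qed.

Definition tmul (a b : with_top K) : with_top K :=
  match a, b with
  | Fin x, Fin y => Fin (x * y)
  | Fin x, Top | Top, Fin x => if x == 0 then Fin 0 else Top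
  | Top, Top => Top
  end.

Definition tdmul (a b : with_top K) : with_top K :=
  match a, b with
  | Fin x, Fin y => Fin (x * y)
  | _, _ => Top
  end.

Definition tinv (a : with_top K) : with_top K :=
  match a with
  | Fin x => if x == 0 then Top else Fin (sinv x)
  | Top => Fin 0
  end.

End TopOrder.

Section Residuation.
Variables (K : bcSemifieldType) (X : bcSemimodType K).

Definition residual (x y : X) : with_top K :=
  supremum Top [set Fin l | l in [set l : K | l *: y <=+ x]].

Definition topical (f : X -> with_top K) : Prop :=
  (forall x y : X, x <=+ y -> f x <= f y) /\
  (forall (x : X) (l : K), f (l *: x) = tmul (Fin l) (f x)).

Definition anti_topical (f : X -> with_top K) : Prop :=
  (forall x y : X, x <=+ y -> f y <= f x) /\
  (forall (x : X) (l : K), f (l *: x) = tdmul (tinv (Fin l)) (f x)).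

Definition s_inf (y : X) (d : with_top K) (x : X) : with_top K :=
  infimum Top [set residual x y; d].

Definition s_sup (y : X) (d : with_top K) (x : X) : with_top K :=
  supremum Top [set tinv (residual x y); d].

End Residuation.

(* Main.v *)
(* The residual x / y is attained when y <> 0, by (A1): (x / y) *: y <= x.
   A topical f hence satisfies x / y * f y = f ((x / y) *: y) <= f x.
   Conversely, 1 <= y / x when x <= y, and l <= (l *: x) / x for all l, so the
   inequality yields monotonicity and one half of homogeneity; the other half
   is the same bound for the inverse of l.  The parameter d is harmless since
   taking d = Top (resp. d = 0) recovers the residual (resp. its inverse). *)
Require Import Defs.
From mathcomp Require Import all_boot all_order all_algebra.
From mathcomp Require Import boolp classical_sets.

Set Implicit Arguments.
Unset Strict Implicit.
Unset Printing Implicit Defensive.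

Import Order.TTheory GRing.Theory.

Local Open Scope ring_scope.

(** * Suprema and infima as values of total functions *)

Section ExtremumOfLub.
Context {d : Order.disp_t} {T : porderType d}.
Local Open Scope classical_set_scope.
Local Open Scope order_scope.
Implicit Types (A : set T) (x : T).

(** [supremum] chooses some least upper bound; antisymmetry leaves only one choice, and the two
    hypotheses rule out the default [x0]. *)
Lemma supremum_lub x0 A x : A !=set0 -> isLub A x -> supremum x0 A = x.
Proof.
move=> /set0P/negPf A0 Ax; rewrite /supremum A0; case: xgetP => [y -> Ay|/(_ x)//].
exact: (is_subset1_supremums Ay).
Qed.

Lemma infimum_glb x0 A x : A !=set0 -> infimums A x -> infimum x0 A = x.
Proof.
move=> /set0P/negPf A0 Ax; rewrite /infimum A0; case: xgetP => [y -> Ay|/(_ x)//].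
exact: (is_subset1_infimums Ay).
Qed.

Lemma supremum2_l x0 x y : y <= x -> supremum x0 [set x; y] = x.
Proof.
move=> yx; apply: supremum_lub; first by exists x; left.
by split=> [z [->|->]//|z]; apply; left.
Qed.

Lemma infimum2_l x0 x y : x <= y -> infimum x0 [set x; y] = x.
Proof.
move=> yx; apply: infimum_glb; first by exists x; left.
by split=> [z [->|->]//|z]; apply; left.
Qed.

End ExtremumOfLub.

(** * Order, products and inversion on the semifield completed by [Top] *)

Section CompletedSemifield.
Variable K : bcSemifieldType.
Implicit Types (x y l : K) (a b c : with_top K).

Lemma leDP (V : idemNmodType) (u v : V) : reflect (u + v = v) (u <=+ v).
Proof. exact: eqP. Qed.

Lemma le_0add (V : idemNmodType) (u : V) : 0 <=+ u.
Proof. by apply/leDP; rewrite add0r. Qed.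

Lemma le_add0 (V : idemNmodType) (u : V) : u <=+ 0 -> u = 0.
Proof. by move/leDP; rewrite addr0. Qed.

Lemma le_mull l x y : x <=+ y -> l * x <=+ l * y.
Proof. by move/leDP=> xy; apply/leDP; rewrite -mulrDr xy. Qed.

Lemma sinv_neq0 x : x != 0 -> sinv x != 0.
Proof.
move=> x0; apply: contraNneq (x0) => sx0.
by rewrite -[x]mulr1 -(mulsV _ x0) sx0 !mulr0.
Qed.

Lemma sinvK x : x != 0 -> sinv (sinv x) = x.
Proof.
move=> x0; rewrite -[LHS]mul1r -(mulsV _ x0) -mulrA mulsV ?mulr1 //.
exact: sinv_neq0.
Qed.

Lemma sinv_anti x y : x != 0 -> x <=+ y -> sinv y <=+ sinv x.
Proof.
move=> x0 xy; have y0 : y != 0.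
  by apply: contra_neq x0 => y0; apply: le_add0; rewrite -y0.
(* Multiplying by both inverses at once cancels [x] on the left and [y] on the right. *)
have := le_mull (sinv x * sinv y) xy.
by rewrite mulrAC [sinv x * x]mulrC mulsV // mul1r -mulrA [_ * y]mulrC mulsV // mulr1.
Qed.

Lemma fin0_le a : Fin 0 <= a.
Proof. by case: a => // x; exact: le_0add. Qed.

Lemma le_Top a : a <= Top.
Proof. by case: a. Qed.

Lemma tmulC a b : tmul a b = tmul b a.
Proof. by case: a b => [x|] [y|] //=; rewrite mulrC. Qed.

Lemma tmul0 a : tmul (Fin 0) a = Fin 0.
Proof. by case: a => [x|] /=; rewrite ?mul0r ?eqxx. Qed.

Lemma tmul1 a : (1 : K) != 0 -> tmul (Fin 1) a = a.
Proof. by case: a => [x|] /= => [_|/negPf->]; rewrite ?mul1r. Qed.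

(** Multiplication by [Top] jumps from [Fin 0] to [Top]; the jump respects the order because only 0
    lies below 0. *)
Lemma tmul_mono a b c : b <= c -> tmul a b <= tmul a c.
Proof.
case: a b c => [x|] [y|] [z|] //=.
- exact: le_mull.
- case: eqVneq => [-> _|_ _]; last exact: le_Top.
  by rewrite mul0r lexx.
- case: eqVneq => [_ _|y0 yz]; first exact: fin0_le.
  case: eqVneq => // z0; case/eqP: y0; apply: le_add0; by rewrite -z0.
- by move=> _; exact: le_Top.
Qed.

(** Cancellation survives at [Top] because [l] and its inverse are both nonzero, so each of them
    fixes [Top]. *)
Lemma tmulVA l a : l != 0 -> tmul (Fin l) (tmul (Fin (sinv l)) a) = a.
Proof.
move=> l0; case: a => [x|] /=; first by rewrite mulrA mulsV ?mul1r.
by rewrite (negPf (sinv_neq0 l0)) (negPf l0).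
Qed.

Lemma tdmulC a b : tdmul a b = tdmul b a.
Proof. by case: a b => [x|] [y|] //=; rewrite mulrC. Qed.

Lemma tdmul1 a : tdmul (Fin 1) a = a.
Proof. by case: a => [x|] //=; rewrite mul1r. Qed.

Lemma tdmul_mono a b c : b <= c -> tdmul a b <= tdmul a c.
Proof. by case: a b c => [x|] [y|] [z|] //=; exact: le_mull. Qed.

Lemma tdmulVA l a : l != 0 -> tdmul (Fin (sinv l)) (tdmul (Fin l) a) = a.
Proof.
by move=> l0; case: a => [x|] //=; rewrite mulrA [_ * l]mulrC mulsV ?mul1r.
Qed.

Lemma tinv_fin l : l != 0 -> tinv (Fin l) = Fin (sinv l).
Proof. by move=> /= /negPf->. Qed.

Lemma tinv1 : (1 : K) != 0 -> tinv (Fin 1) = Fin 1 :> with_top K.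
Proof. by move=> n0; rewrite tinv_fin // -[sinv 1]mul1r mulsV. Qed.

Lemma tinv_anti a b : a <= b -> tinv b <= tinv a.
Proof.
case: a b => [x|] [y|] //=; last by move=> _; exact: fin0_le.
case: (eqVneq x 0) => [_ _|x0 xy]; first exact: le_Top.
case: eqVneq => [y0|_]; last exact: sinv_anti.
by case/eqP: x0; apply: le_add0; rewrite -y0.
Qed.

End CompletedSemifield.

(** * Residuals and the inequalities for topical and anti-topical functions *)

Section ResiduationTheory.
Context {K : bcSemifieldType} {X : bcSemimodType K}.
Implicit Types (x y : X) (l : K) (d : with_top K) (f : X -> with_top K).

Lemma residual_lub x y :
  isLub (fun a => exists2 l, l *: y <=+ x & Fin l = a) (residual x y).
Proof.
set A := (A in isLub A _); have A0 : (A !=set0)%classic.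
  (* The scalar 0 always qualifies, so [residual] is a true supremum and never the default of an
     empty set. *)
  by exists (Fin 0), 0 => //; rewrite scale0r; exact: le_0add.
have [s lubs] := with_top_lub A.
by rewrite /residual (supremum_lub Top A0 lubs).
Qed.

Lemma le_residual x y l : l *: y <=+ x -> Fin l <= residual x y.
Proof. by move=> lyx; apply: (residual_lub x y).1; exists l. Qed.

(** (A1) and b-completeness give the scalars a supremum [s] in [K]. As the action preserves suprema,
    [s *: y] is the supremum of vectors below [x], hence below [x]. *)
Lemma residual_attained x y : condA1 X -> y != 0 ->
  exists2 s, residual x y = Fin s & s *: y <=+ x.
Proof.
move=> hA1 y0; have /bcomplete[s [ubs lubs]] := hA1 x y y0.
exists s; last first.
  have [_] := @scale_supl _ X _ _ y (conj ubs lubs).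
  by apply=> _ [l lyx <-].
apply/eqP; rewrite eq_le; apply/andP; split.
  by apply: (residual_lub x y).2 => _ [l lyx <-]; exact: ubs.
have [ub _] := residual_lub x y; case: (residual x y) ub => [r|] // ub.
by apply: lubs => l lyx; apply: (ub (Fin l)); exists l.
Qed.

Lemma s_inf_le_residual x y d : s_inf y d x <= residual x y.
Proof.
have [g glb] := with_top_glb [set residual x y; d]%classic.
rewrite /s_inf (infimum_glb _ _ glb); last by exists d; right.
by apply: glb.1; left.
Qed.

Lemma s_inf_Top x y : s_inf y Top x = residual x y.
Proof. by rewrite /s_inf infimum2_l ?le_Top. Qed.

Lemma tinv_residual_le_s_sup x y d : tinv (residual x y) <= s_sup y d x.
Proof.
have [s lubs] := with_top_lub [set tinv (residual x y); d]%classic.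
rewrite /s_sup (supremum_lub _ _ lubs); last by exists d; right.
by apply: lubs.1; left.
Qed.

Lemma s_sup_Fin0 x y : s_sup y (Fin 0) x = tinv (residual x y).
Proof. by rewrite /s_sup supremum2_l ?fin0_le. Qed.

(** If 1 = 0, then [K] collapses to 0, which is then its greatest element. Nontriviality makes
    [Fin 1] neutral for [tmul] at [Top] as well. *)
Lemma one_neq0 : no_greatest K -> (1 : K) != 0.
Proof.
apply: contra_notN => /eqP K0; exists 0 => l.
by rewrite -[l]mulr1 K0 mulr0.
Qed.

Lemma topical_residual f : condA1 X -> topical f ->
  f 0 = Fin 0 /\ forall x y, tmul (f y) (residual x y) <= f x.
Proof.
move=> hA1 [fle fhom].
have f0 : f 0 = Fin 0 by rewrite -(scale0r 0) fhom tmul0.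
(* (A1) says nothing at [y = 0]; there [f 0 = Fin 0] absorbs the residual. *)
split=> // x y; have [->|/(residual_attained x hA1)[s -> syx]] := eqVneq y 0.
  by rewrite f0 tmul0 fin0_le.
by rewrite tmulC -fhom; exact: fle.
Qed.

Lemma residual_topical f : no_greatest K ->
    f 0 = Fin 0 -> (forall x y, tmul (f y) (residual x y) <= f x) ->
  topical f.
Proof.
move=> hK f0 fres.
have fsub x l : tmul (Fin l) (f x) <= f (l *: x).
  by rewrite tmulC; apply: le_trans (fres _ x); apply/tmul_mono/le_residual.
split=> [x y xy|x l].
  rewrite -[f x](tmul1 _ (one_neq0 hK)) tmulC; apply: le_trans (fres y x).
  by apply/tmul_mono/le_residual; rewrite scale1r.
have [->|l0] := eqVneq l 0; first by rewrite scale0r tmul0.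
(* After factoring out [l], the claim is [fsub] at the vector [l *: x] and the scalar [sinv l]. *)
apply/eqP; rewrite eq_le fsub andbT -[f (l *: x)](tmulVA _ l0); apply: tmul_mono.
by apply: le_trans (fsub _ _) _; rewrite scalerA mulrC mulsV // scale1r.
Qed.

Lemma anti_topical_residual f : condA1 X -> anti_topical f ->
  f 0 = Top /\ forall x y, f x <= tdmul (f y) (tinv (residual x y)).
Proof.
move=> hA1 [fle fhom].
have f0 : f 0 = Top by rewrite -(scale0r 0) fhom /= eqxx.
(* At [y = 0] the right-hand side is [Top], which absorbs under [tdmul]. *)
split=> // x y; have [->|/(residual_attained x hA1)[s -> syx]] := eqVneq y 0.
  by rewrite f0 le_Top.
by rewrite tdmulC -fhom; exact: fle.
Qed.

Lemma residual_anti_topical f : no_greatest K ->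
    f 0 = Top -> (forall x y, f x <= tdmul (f y) (tinv (residual x y))) ->
  anti_topical f.
Proof.
move=> hK f0 fres.
have fsub x l : f (l *: x) <= tdmul (tinv (Fin l)) (f x).
  rewrite tdmulC; apply: le_trans (fres _ x) _.
  exact/tdmul_mono/tinv_anti/le_residual.
split=> [x y xy|x l].
  rewrite -[f x]tdmul1 tdmulC -(tinv1 (one_neq0 hK)).
  apply: le_trans (fres y x) _.
  by apply/tdmul_mono/tinv_anti/le_residual; rewrite scale1r.
(* At [l = 0] both sides are [Top], since [tinv (Fin 0)] is [Top]. *)
have [->|l0] := eqVneq l 0; first by rewrite scale0r /= eqxx.
apply/eqP; rewrite eq_le fsub tinv_fin //=.
rewrite -[f (l *: x)](tdmulVA _ l0); apply: tdmul_mono.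
(* Inverting twice turns this instance into the bound of [f x] by [l] times [f (l *: x)]. *)
have := fsub (l *: x) (sinv l).
by rewrite tinv_fin ?sinv_neq0 // sinvK // scalerA mulrC mulsV // scale1r.
Qed.

End ResiduationTheory.

Theorem theorem20 (K : bcSemifieldType) (X : bcSemimodType K)
    (hK : no_greatest K) (hA1 : condA1 X) :
  (forall f : X -> with_top K,
    [<-> topical f;
         f 0 = Fin 0 /\
           (forall x y : X, tmul (f y) (residual x y) <= f x);
         f 0 = Fin 0 /\
           (forall (x y : X) (d : with_top K),
              tmul (f y) (s_inf y d x) <= f x)]) /\
  (forall f : X -> with_top K,
    [<-> anti_topical f;
         f 0 = Top /\
           (forall x y : X, f x <= tdmul (f y) (tinv (residual x y)));
         f 0 = Top /\
           (forall (x y : X) (d : with_top K),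
              f x <= tdmul (f y) (s_sup y d x))]).
Proof.
split=> f; tfae.
- exact: topical_residual.
- move=> [f0 fres]; split=> // x y d.
  exact: le_trans (tmul_mono _ (s_inf_le_residual x y d)) (fres x y).
- move=> [f0 fs]; apply: residual_topical => // x y.
  by rewrite -s_inf_Top; exact: fs.
- exact: anti_topical_residual.
- move=> [f0 fres]; split=> // x y d.
  exact: le_trans (fres x y) (tdmul_mono _ (tinv_residual_le_s_sup x y d)).
- move=> [f0 fs]; apply: residual_anti_topical => // x y.
  by rewrite -s_sup_Fin0; exact: fs.
Qed.
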